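(* Let $A\in\mathbb R_+^{n\times n}$, $B=[B_1\ \cdots\ B_m]\in\mathbb R^{n\times m}$, $E=[E_1^\top\ \cdots\ E_m^\top]^\top\in\mathbb R_+^{m\times n}$ (with columns $B_i$ of $B$ and rows $E_i$ of $E$), $s\in\mathbb R_+^n$, $r\in\mathbb R^m$ and $\gamma\in\mathbb R_+^n$. Suppose that $A\ge|B|E$ and $s\ge E^\top|r|$. Consider the problem $$\inf_\mu\ \sup_{w\ge-(Ax+Bu)}\ \sum_{t=0}^\infty\bigl(s^\top x_t+r^\top u_t-\gamma^\top|w_t|\bigr)$$ subject to $x_{t+1}=Ax_t+Bu_t+w_t$, $x_0\in\mathbb R_+^n$, $u_t=\mu_t(x_t)$, $|u_t|\le Ex_t$. Then the following statements are equivalent: (i) The problem has finite value for every $x_0\in\mathbb R_+^n$. (ii) The recursive sequence $\{p_k\}_{k=0}^\infty$, with $p_0=0$ and $$p_k=s+A^\top p_{k-1}-E^\top\bigl|r+B^\top p_{k-1}\bigr|,\qquad k\ge1,$$ has a finite limit $p\in\mathbb R_+^n$ satisfying $p\le\gamma$. (iii) There exists $p\in\mathbb R_+^n$ such that $$p=s+A^\top p-E^\top\bigl|r+B^\top p\bigr|,\qquad\gamma\ge p.$$ If these conditions hold, then the problem has the optimal value $p^\top x_0$, where $p$ is the limit of the sequence in (ii), which solves the algebraic equation in (iii). Moreover, an optimal control law is $u_t=-Kx_t$, where $$K=\begin{bmatrix}\operatorname{sign}(r_1+p^\top B_1)E_1\\ \vdots\\ \operatorname{sign}(r_m+p^\top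 B_m)E_m\end{bmatrix}.$$
   Context: Inequalities and absolute values of vectors and matrices are elementwise; $\mathbb R_+^n$ is the nonnegative orthant. The supremum is over disturbance sequences $w=(w_t)_{t\ge0}$ in $\mathbb R^n$ with $w_t\ge-(Ax_t+Bu_t)$ for all $t$ (so that the state stays nonnegative; $w_t$ may have negative entries). *)

(* Defs.v *)
From HB Require Import structures.
From mathcomp Require Import all_boot all_order all_algebra.
From mathcomp Require Import all_classical all_reals all_analysis.

Set Implicit Arguments.
Unset Strict Implicit.
Unset Printing Implicit Defensive.

Import Order.TTheory GRing.Theory Num.Theory.
Import numFieldNormedType.Exports.

Local Open Scope classical_set_scope.
Local Open Scope ring_scope.

(* Elementwise order and absolute value. MathComp-Analysis' [`|M|] on matrices
   is the max-norm (a scalar), hence a separate operation. *)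
Definition mxle (R : numDomainType) (a b : nat) (M N : 'M[R]_(a, b)) : Prop :=
  forall i j, M i j <= N i j.

Definition mxabs (R : numDomainType) (a b : nat) (M : 'M[R]_(a, b)) :
  'M[R]_(a, b) := map_mx Num.norm M.

Notation "M <=m N" := (mxle M N) (at level 70, no associativity) : ring_scope.

Definition dotv (R : numDomainType) (n : nat) (y x : 'cV[R]_n) : R :=
  (y^T *m x) 0 0.

Section MinimaxProblem.
Variables (R : realType) (n m : nat).
Variables (A : 'M[R]_n) (B : 'M[R]_(n, m)) (E : 'M[R]_(m, n)).
Variables (s : 'cV[R]_n) (r : 'cV[R]_m) (gamma : 'cV[R]_n).

(* A policy is a time-varying state feedback; [mu t x] is the input applied at
   time [t] in state [x]. *)
Definition policy : Type := nat -> 'cV[R]_n -> 'cV[R]_m.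

(* From time 1 on, every nonnegative state is reachable by some admissible
   disturbance, and [mu 0] only matters at the initial state; so the input
   constraint along all trajectories is a constraint at every nonnegative
   state. *)
Definition admissible_policy (mu : policy) : Prop :=
  forall (t : nat) (x : 'cV[R]_n), 0 <=m x -> mxabs (mu t x) <=m E *m x.

Fixpoint state (mu : policy) (w : nat -> 'cV[R]_n) (x0 : 'cV[R]_n) (t : nat) :
  'cV[R]_n :=
  if t is t'.+1 then
    A *m state mu w x0 t' + B *m mu t' (state mu w x0 t') + w t'
  else x0.

Definition input (mu : policy) (w : nat -> 'cV[R]_n) (x0 : 'cV[R]_n) (t : nat) :
  'cV[R]_m := mu t (state mu w x0 t).

Definition admissible_disturbance (mu : policy) (x0 : 'cV[R]_n)
    (w : nat -> 'cV[R]_n) : Prop :=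
  forall t, - (A *m state mu w x0 t + B *m input mu w x0 t) <=m w t.

Definition stage_cost (x : 'cV[R]_n) (u : 'cV[R]_m) (w : 'cV[R]_n) : R :=
  dotv s x + dotv r u - dotv gamma (mxabs w).

(* The stage costs have no fixed sign, so the series is read as the limsup of its
   partial sums in the extended reals, which is the limit whenever that exists. *)
Definition total_cost (mu : policy) (x0 : 'cV[R]_n) (w : nat -> 'cV[R]_n) :
  \bar R :=
  limn_esup (fun T : nat =>
    (\sum_(0 <= t < T)
        stage_cost (state mu w x0 t) (input mu w x0 t) (w t))%:E).

Definition worst_cost (mu : policy) (x0 : 'cV[R]_n) : \bar R :=
  ereal_sup [set total_cost mu x0 w | w in admissible_disturbance mu x0].

Definition value (x0 : 'cV[R]_n) : \bar R :=
  ereal_inf [set worst_cost mu x0 | mu in admissible_policy].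

Definition optimal_policy (mu : policy) (x0 : 'cV[R]_n) : Prop :=
  admissible_policy mu /\ worst_cost mu x0 = value x0.

Definition bellman (p : 'cV[R]_n) : 'cV[R]_n :=
  s + A^T *m p - E^T *m mxabs (r + B^T *m p).

Definition pseq (k : nat) : 'cV[R]_n := iter k bellman 0.

(* [Num.sg 0 = 0]. *)
Definition gain (p : 'cV[R]_n) : 'M[R]_(m, n) :=
  \matrix_(i < m) (Num.sg (r i 0 + dotv p (col i B)) *: row i E).

End MinimaxProblem.

(* Main.v *)
Require Import Defs.
From HB Require Import structures.
From mathcomp Require Import all_boot all_order all_algebra.
From mathcomp Require Import all_classical all_reals all_analysis.
From mathcomp Require Import ring lra.

(** The game is linear in the state, and the Bellman operator maps the linear
    function [p . x] to [bellman p . x]: minimising [(r + B^T p) . u] over the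
    box [|u| <= E x] gives [- |r + B^T p| . (E x)], attained by the sign feedback
    ([bellman_le], [bellman_gainE]). The hypothesis [|B| E <= A] makes the
    operator monotone and [E^T |r| <= s] makes its first iterate nonnegative,
    so the iterates from 0 increase; they converge as soon as they are bounded,
    and the limit is the least nonnegative fixed point.

    For the lower bound, let the adversary add [d >= 0] at time 0 and nothing
    afterwards. Dynamic programming bounds the cost of [T] undisturbed steps from
    below by the [T]-th iterate, which dominates the earlier ones. Hence every
    policy costs at least [pseq k.+1 . x0 + (pseq k - gamma) . d]
    ([impulse_cost_ge]). If the value is finite at [x0 = 0], this forces all
    iterates below [gamma] ([pseq_le_gamma]), so they converge to some
    [p <= gamma]. With [d = 0] it says that the value is at least [p . x0].

    For the upper bound, let [p <= gamma] be a fixed point. Then [p . x] is a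
    storage function for the sign feedback: each stage costs at most the decrease
    of [p . x] along the trajectory, so every disturbance costs at most [p . x0]
    ([worst_cost_gain_le]). Both bounds agree at the limit of the iterates. *)

Set Implicit Arguments.
Unset Strict Implicit.
Unset Printing Implicit Defensive.

Import Order.TTheory GRing.Theory Num.Theory.
Import numFieldNormedType.Exports.

Local Open Scope classical_set_scope.
Local Open Scope ring_scope.

(** * Elementwise order and inner products of column vectors *)

Section ElementwiseOrder.
Variable R : realDomainType.

Lemma dotvE k (y x : 'cV[R]_k) : dotv y x = \sum_i y i 0 * x i 0.
Proof. by rewrite /dotv mxE; apply: eq_bigr => i _; rewrite mxE. Qed.

Lemma dotvDl k (y z x : 'cV[R]_k) : dotv (y + z) x = dotv y x + dotv z x.
Proof. by rewrite /dotv raddfD mulmxDl mxE. Qed.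

Lemma dotvBl k (y z x : 'cV[R]_k) : dotv (y - z) x = dotv y x - dotv z x.
Proof. by rewrite /dotv raddfB mulmxBl !mxE. Qed.

Lemma dotvDr k (y x z : 'cV[R]_k) : dotv y (x + z) = dotv y x + dotv y z.
Proof. by rewrite /dotv mulmxDr mxE. Qed.

Lemma dotv0 k (y : 'cV[R]_k) : dotv y 0 = 0.
Proof. by rewrite /dotv mulmx0 mxE. Qed.

Lemma dotv_trmxl k l (M : 'M[R]_(k, l)) (y : 'cV_k) (x : 'cV_l) :
  dotv (M^T *m y) x = dotv y (M *m x).
Proof. by rewrite /dotv trmx_mul trmxK mulmxA. Qed.

Lemma dotv_scale_delta k (y : 'cV[R]_k) (c : R) (i : 'I_k) :
  dotv y (c *: delta_mx i 0) = c * y i 0.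
Proof. by rewrite /dotv -scalemxAr -colE !mxE. Qed.

Lemma ler_dotvl k (y z x : 'cV[R]_k) :
  0 <=m x -> y <=m z -> dotv y x <= dotv z x.
Proof.
move=> x0 yz; rewrite !dotvE; apply: ler_sum => i _.
by apply: ler_wpM2r => //; have := x0 i 0; rewrite mxE.
Qed.

Lemma dotv_ge0 k (y x : 'cV[R]_k) : 0 <=m y -> 0 <=m x -> 0 <= dotv y x.
Proof.
move=> y0 x0; rewrite dotvE; apply: sumr_ge0 => i _.
by apply: mulr_ge0; [have := y0 i 0 | have := x0 i 0]; rewrite mxE.
Qed.

(** For the budget [z = E x] this bounds the effect of any admissible input [u]
    on a linear functional; the bound is attained by the sign feedback [gain]. *)
Lemma dotv_ge_Nabs k (v u z : 'cV[R]_k) :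
  mxabs u <=m z -> - dotv (mxabs v) z <= dotv v u.
Proof.
move=> uz; rewrite !dotvE -sumrN; apply: ler_sum => i _; rewrite mxE.
have := uz i 0; rewrite mxE => ui.
apply: le_trans (lerNnormlW (lexx `|v i 0 * u i 0|)); rewrite lerN2 normrM.
exact: ler_wpM2l.
Qed.

Lemma mxle_trans k l (M N P : 'M[R]_(k, l)) : M <=m N -> N <=m P -> M <=m P.
Proof. by move=> MN NP i j; apply: le_trans (MN i j) (NP i j). Qed.

Lemma mulmx_ge0 k l (M : 'M[R]_(k, l)) (x : 'cV_l) :
  0 <=m M -> 0 <=m x -> 0 <=m M *m x.
Proof.
move=> M0 x0 i j; rewrite !mxE; apply: sumr_ge0 => h _.
by apply: mulr_ge0; [have := M0 i h | have := x0 h j]; rewrite mxE.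
Qed.

Lemma mxabs_ge0 k l (M : 'M[R]_(k, l)) : 0 <=m mxabs M.
Proof. by move=> i j; rewrite !mxE. Qed.

Lemma mxabs_mulmx_le k l (M : 'M[R]_(k, l)) (x : 'cV_l) :
  mxabs (M *m x) <=m mxabs M *m mxabs x.
Proof.
move=> i j; rewrite !mxE; apply: le_trans (ler_norm_sum _ _ _) _.
by apply: ler_sum => h _; rewrite normrM !mxE.
Qed.

Lemma ler_mulmxl k l (M : 'M[R]_(k, l)) (x y : 'cV_l) :
  0 <=m M -> x <=m y -> M *m x <=m M *m y.
Proof.
move=> M0 xy i j; rewrite !mxE; apply: ler_sum => h _.
by apply: ler_wpM2l => //; have := M0 i h; rewrite mxE.
Qed.

Lemma ler_mulmxr k l (M N : 'M[R]_(k, l)) (x : 'cV_l) :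
  M <=m N -> 0 <=m x -> M *m x <=m N *m x.
Proof.
move=> MN x0 i j; rewrite !mxE; apply: ler_sum => h _.
by apply: ler_wpM2r => //; have := x0 h j; rewrite mxE.
Qed.

Lemma trmx_ge0 k l (M : 'M[R]_(k, l)) : 0 <=m M -> 0 <=m M^T.
Proof. by move=> M0 i j; have := M0 j i; rewrite !mxE. Qed.

Lemma trmx_le k l (M N : 'M[R]_(k, l)) : M <=m N -> M^T <=m N^T.
Proof. by move=> MN i j; rewrite !mxE. Qed.

Lemma mxabs_tr k l (M : 'M[R]_(k, l)) : mxabs M^T = (mxabs M)^T.
Proof. by apply/matrixP => i j; rewrite !mxE. Qed.

Lemma mxabs_id k l (M : 'M[R]_(k, l)) : 0 <=m M -> mxabs M = M.
Proof.
by move=> M0; apply/matrixP => i j; have := M0 i j; rewrite !mxE => /ger0_norm.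
Qed.

End ElementwiseOrder.

(** * Coordinatewise convergence and bounds on limits superior *)

Section Limits.
Variable R : realType.

(** The normed-module structure on matrices requires positive dimensions. For
    arbitrary [k] the matrix topology is reduced to its coordinates. *)
Lemma cvg_colP k (u : nat -> 'cV[R]_k) (p : 'cV[R]_k) :
  u @ \oo --> p <-> forall i, u t i 0 @[t --> \oo] --> p i 0.
Proof.
split=> [up i|up].
  apply: (@continuous_cvg _ _ _ \oo _ u (fun M : 'cV[R]_k => M i 0)) => //.
  exact: coord_continuous.
apply/cvg_mx_entourageP => V entV.
apply: filter_forall => i; apply: filter_forall => j; rewrite (ord1 j).
have /cvg_entourageP/(_ V entV) := up i; rewrite !near_simpl.
by apply: filterS => t /=; exact: mem_set.
Qed.

Lemma cvg_sumr (I : Type) (l : seq I) (f : I -> nat -> R) (a : I -> R) :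
  (forall i, f i t @[t --> \oo] --> a i) ->
  (\sum_(i <- l) f i t) @[t --> \oo] --> \sum_(i <- l) a i.
Proof.
by move=> fa; apply: cvg_big => //; exact: add_continuous.
Qed.

Lemma cvg_mulmx k l (M : 'M[R]_(k, l)) (u : nat -> 'cV[R]_l) (p : 'cV[R]_l) :
  u @ \oo --> p -> (M *m u t) @[t --> \oo] --> M *m p.
Proof.
move=> /cvg_colP up; apply/cvg_colP => i.
under eq_fun do rewrite mxE; rewrite mxE.
by apply: cvg_sumr => j; apply: cvgMl_tmp.
Qed.

Lemma cvg_mxabs k (u : nat -> 'cV[R]_k) (p : 'cV[R]_k) :
  u @ \oo --> p -> mxabs (u t) @[t --> \oo] --> mxabs p.
Proof.
move=> /cvg_colP up; apply/cvg_colP => i.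
by under eq_fun do rewrite mxE; rewrite mxE; apply: cvg_norm.
Qed.

Lemma cvg_addmx k (u v : nat -> 'cV[R]_k) (p q : 'cV[R]_k) : u @ \oo --> p ->
  v @ \oo --> q -> (u t + v t) @[t --> \oo] --> p + q.
Proof.
move=> /cvg_colP up /cvg_colP vq; apply/cvg_colP => i.
by under eq_fun do rewrite mxE; rewrite mxE; apply: cvgD.
Qed.

Lemma cvg_oppmx k (u : nat -> 'cV[R]_k) (p : 'cV[R]_k) :
  u @ \oo --> p -> (- u t) @[t --> \oo] --> - p.
Proof.
move=> /cvg_colP up; apply/cvg_colP => i.
by under eq_fun do rewrite mxE; rewrite mxE; apply: cvgN.
Qed.

Lemma cvg_dotvl k (u : nat -> 'cV[R]_k) (p x : 'cV[R]_k) :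
  u @ \oo --> p -> dotv (u t) x @[t --> \oo] --> dotv p x.
Proof.
move=> /cvg_colP up; under eq_fun do rewrite dotvE; rewrite dotvE.
by apply: cvg_sumr => i; apply: cvgMr_tmp.
Qed.

Lemma limn_esup_le (u : nat -> \bar R) l :
  (forall t, (u t <= l)%E) -> (limn_esup u <= l)%E.
Proof.
move=> ul; apply: (@le_trans _ _ (ereal_sup (u @` setT))).
  by apply: ereal_inf_lbound; exists setT => //; exact: filterT.
by apply: ge_ereal_sup => _ [t _ <-].
Qed.

Lemma limn_esup_ge (u : nat -> \bar R) l T :
  (forall t, (T <= t)%N -> (l <= u t)%E) -> (l <= limn_esup u)%E.
Proof.
move=> lu; apply: le_ereal_inf_tmp => _ [V [N _ NV] <-].
apply: le_trans (lu (maxn T N) (leq_maxl _ _)) _.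
by apply: ereal_sup_ubound; exists (maxn T N) => //; apply: NV; apply: leq_maxr.
Qed.

End Limits.

(** * The Bellman operator and its iterates *)

Section Problem.
Variables (R : realType) (n m : nat).
Variables (A : 'M[R]_n) (B : 'M[R]_(n, m)) (E : 'M[R]_(m, n)).
Variables (s : 'cV[R]_n) (r : 'cV[R]_m) (gamma : 'cV[R]_n).
Hypotheses (E_ge0 : 0 <=m E).
Hypotheses (BE_le_A : mxabs B *m E <=m A) (Er_le_s : E^T *m mxabs r <=m s).

Local Notation bellman := (bellman A B E s r).
Local Notation pseq := (pseq A B E s r).

(** With [d = q - p >= 0], the map [E^T |r + B^T .|] grows by at most
    [E^T |B|^T d], which [A^T d] dominates because [|B| E <= A]. *)
Lemma bellman_mono p q : p <=m q -> bellman p <=m bellman q.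
Proof.
move=> pq; set d := q - p.
have d_ge0 : 0 <=m d by move=> i j; rewrite !mxE subr_ge0.
have abs_d : mxabs d = d by exact: mxabs_id.
have Bd_le : mxabs (r + B^T *m q) <=m mxabs (r + B^T *m p) + mxabs B^T *m d.
  move=> i j; have := mxabs_mulmx_le B^T d i j; rewrite abs_d => Bd.
  have -> : q = p + d by rewrite addrC subrK.
  rewrite mulmxDr addrA [X in _ <= X]mxE; apply: le_trans _ (lerD (lexx _) Bd).
  by rewrite !mxE; apply: ler_normD.
have EBd_le : E^T *m (mxabs B^T *m d) <=m A^T *m d.
  rewrite mulmxA mxabs_tr -trmx_mul.
  exact: ler_mulmxr (trmx_le BE_le_A) d_ge0.
move=> i j; have := ler_mulmxl (trmx_ge0 E_ge0) Bd_le i j.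
have -> : bellman q = bellman p + A^T *m d
    + (E^T *m mxabs (r + B^T *m p) - E^T *m mxabs (r + B^T *m q)).
  rewrite /Defs.bellman /d mulmxBr.
  by apply/matrixP => a b; rewrite !mxE; ring.
rewrite mulmxDr; have := EBd_le i j.
move: (bellman p) (A^T *m d) (E^T *m _) (E^T *m _) (E^T *m _) => x1 x2 x3 x4 x5.
rewrite !mxE; lra.
Qed.

(** The first step [0 <= s - E^T |r|] is the hypothesis on [s]; monotonicity of
    the Bellman operator propagates it. *)
Lemma pseq_le_succ k : pseq k <=m pseq k.+1.
Proof.
elim: k => [|k IH]; last exact: bellman_mono.
move=> i j; have := Er_le_s i j.
rewrite /= /Defs.bellman !mulmx0 !addr0 -subr_ge0 => h.
by rewrite [X in X <= _]mxE [X in _ <= X]mxE [X in _ + X]mxE.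
Qed.

Lemma pseq_nondecreasing k l : (k <= l)%N -> pseq k <=m pseq l.
Proof.
move=> /subnKC <-; elim: (l - k)%N => [|d IH]; first by rewrite addn0.
by rewrite addnS; apply: mxle_trans IH (pseq_le_succ _).
Qed.

Lemma pseq_ge0 k : 0 <=m pseq k.
Proof. exact: (@pseq_nondecreasing 0). Qed.

(** The limit of the iterates is thus the least nonnegative fixed point, so any
    such point below [gamma] forces the limit below [gamma]. *)
Lemma pseq_le_fixpoint q : 0 <=m q -> bellman q = q -> forall k, pseq k <=m q.
Proof.
move=> q0 qE; elim=> [//|k IH]; rewrite -qE; exact: bellman_mono.
Qed.

Lemma pseq_bounded_cvg g : (forall k, pseq k <=m g) ->
  exists p : 'cV[R]_n, [/\ pseq @ \oo --> p, 0 <=m p & p <=m g].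
Proof.
move=> pg.
have cvg_coord i : cvgn (fun k => pseq k i 0).
  apply: nondecreasing_is_cvgn; first by move=> k l /pseq_nondecreasing; apply.
  by exists (g i 0) => _ [k _ <-]; apply: pg.
exists (\col_i limn (fun k => pseq k i 0)); split.
- by apply/cvg_colP => i; rewrite mxE; apply: cvg_coord.
- move=> i j; rewrite (ord1 j) !mxE; apply: limr_ge; first exact: cvg_coord.
  by apply: nearW => k; have := pseq_ge0 k i 0; rewrite mxE.
- move=> i j; rewrite (ord1 j) mxE; apply: limr_le; first exact: cvg_coord.
  by apply: nearW => k; apply: pg.
Qed.

Lemma cvg_bellman (u : nat -> 'cV[R]_n) (p : 'cV[R]_n) :
  u @ \oo --> p -> bellman (u t) @[t --> \oo] --> bellman p.
Proof.
move=> up; rewrite /Defs.bellman; apply: cvg_addmx.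
  by apply: cvg_addmx; [exact: cvg_cst | exact: cvg_mulmx].
apply/cvg_oppmx/cvg_mulmx/cvg_mxabs/cvg_addmx; first exact: cvg_cst.
exact: cvg_mulmx.
Qed.

Lemma pseq_lim_fixpoint (p : 'cV[R]_n) : pseq @ \oo --> p -> p = bellman p.
Proof.
move=> pp; have /cvg_colP bp := cvg_bellman pp; have /cvg_colP cp := pp.
apply/matrixP => i j; rewrite (ord1 j).
apply: cvg_unique (bp i) => //.
by have := cp i; rewrite -cvg_shiftS.
Qed.

(** * One step of dynamic programming *)

(** Completing the Bellman equation: the cost of one undisturbed step followed
    by the terminal cost [p . x] exceeds [bellman p . x] by a bracket that
    [|u| <= E x] makes nonnegative and that vanishes under the sign feedback. *)
Lemma bellman_dotvE p x u :
  dotv s x + dotv r u + dotv p (A *m x + B *m u) =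
  dotv (bellman p) x
    + (dotv (mxabs (r + B^T *m p)) (E *m x) + dotv (r + B^T *m p) u).
Proof.
rewrite /Defs.bellman dotvBl 2!dotvDl !dotv_trmxl dotvDr.
ring.
Qed.

Lemma bellman_le p x u : mxabs u <=m E *m x ->
  dotv (bellman p) x <= dotv s x + dotv r u + dotv p (A *m x + B *m u).
Proof.
by move=> ux; rewrite bellman_dotvE; have := dotv_ge_Nabs (r + B^T *m p) ux; lra.
Qed.

Lemma gain_mulE p (x : 'cV[R]_n) i :
  (gain B E r p *m x) i (0 : 'I_1) = Num.sg ((r + B^T *m p) i 0) * (E *m x) i 0.
Proof.
rewrite !mxE mulr_sumr; apply: eq_bigr => j _; rewrite !mxE mulrA.
congr (Num.sg (_ + _) * _ * _).
by rewrite dotvE; apply: eq_bigr => l _; rewrite !mxE mulrC.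
Qed.

(** [Num.sg v_i * v_i = |v_i|] also when [v_i = 0], so the convention for the
    sign of zero does not affect the cost. *)
Lemma bellman_gainE p x :
  dotv s x + dotv r (- (gain B E r p *m x))
    + dotv p (A *m x + B *m - (gain B E r p *m x)) = dotv (bellman p) x.
Proof.
rewrite bellman_dotvE; set v := r + _.
suff -> : dotv v (- (gain B E r p *m x)) = - dotv (mxabs v) (E *m x).
  by rewrite subrr addr0.
rewrite !dotvE -sumrN; apply: eq_bigr => i _.
rewrite [(- _ : 'cV_m) i 0]mxE gain_mulE -/v [mxabs v i 0]mxE normrEsg; ring.
Qed.

Lemma gain_admissible p :
  admissible_policy E (fun _ x => - (gain B E r p *m x)).
Proof.
move=> t x x0 i j; rewrite (ord1 j) mxE mxE normrN gain_mulE normrM.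
have Ex := mulmx_ge0 E_ge0 x0 i 0; rewrite mxE in Ex.
rewrite (ger0_norm Ex) ler_piMl // normr_sg.
by case: (_ != 0).
Qed.

(** Since [|B u| <= |B| E x <= A x], the uncontrolled growth absorbs every
    admissible input; hence any nonnegative disturbance is admissible. *)
Lemma undisturbed_ge0 (x : 'cV[R]_n) (u : 'cV[R]_m) :
  0 <=m x -> mxabs u <=m E *m x -> 0 <=m A *m x + B *m u.
Proof.
move=> x0 ux i j.
have B0 := mxabs_ge0 B.
have h : mxabs (B *m u) <=m A *m x.
  apply: mxle_trans (mxabs_mulmx_le B u) _.
  apply: mxle_trans (ler_mulmxl B0 ux) _.
  by rewrite mulmxA; apply: ler_mulmxr.
have := h i j; rewrite [X in X <= _]mxE ler_norml => /andP[+ _].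
by rewrite [X in _ -> X <= _]mxE [X in _ -> _ <= X]mxE -lerBlDl sub0r.
Qed.

(** Dynamic programming over a finite horizon: [pseq k] bounds from below the
    cost of [k] undisturbed steps, whatever the inputs. The statement is about
    arbitrary sequences so that it applies to tails of trajectories. *)
Lemma undisturbed_cost_ge k (x : nat -> 'cV[R]_n) (u : nat -> 'cV[R]_m) :
  (forall t, x t.+1 = A *m x t + B *m u t) ->
  (forall t, mxabs (u t) <=m E *m x t) ->
  dotv (pseq k) (x 0%N) <= \sum_(0 <= t < k) (dotv s (x t) + dotv r (u t)).
Proof.
elim: k x u => [|k IH] x u dyn ux.
  by rewrite big_geq // dotvE big1 // => i _; rewrite mxE mul0r.
rewrite big_nat_recl //; apply: le_trans (bellman_le (pseq k) (ux 0%N)) _.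
rewrite lerD2l -dyn.
by apply: (IH (x \o S) (u \o S)) => t; [exact: dyn|exact: ux].
Qed.

(** * Closed-loop trajectories under an impulse disturbance *)

Section Trajectories.
Variables (mu : policy R n m) (x0 : 'cV[R]_n).
Hypotheses (mu_adm : admissible_policy E mu) (x0_ge0 : 0 <=m x0).

Lemma state_ge0 w : admissible_disturbance A B mu x0 w ->
  forall t, 0 <=m state A B mu w x0 t.
Proof.
move=> wadm [//|t] i j; have := wadm t i j.
by rewrite /= /input [X in X <= _]mxE [X in _ -> X <= _]mxE
  [X in _ -> _ <= X]mxE -lerBlDl sub0r.
Qed.

Definition impulse (d : 'cV[R]_n) (t : nat) : 'cV[R]_n :=
  if t is 0%N then d else 0.

Variable d : 'cV[R]_n.
Hypothesis d_ge0 : 0 <=m d.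

Local Notation x := (state A B mu (impulse d) x0).
Local Notation u := (input A B mu (impulse d) x0).

Lemma impulse_state_ge0 t : 0 <=m x t.
Proof.
elim: t => [//|t IH] i j; rewrite /=.
rewrite mxE [X in _ <= X]mxE; apply: addr_ge0.
  by have := undisturbed_ge0 IH (mu_adm t IH) i j; rewrite [X in X <= _]mxE.
by case: t {IH} => [|t] /=; [have := d_ge0 i j|]; rewrite mxE.
Qed.

Lemma impulse_admissible : admissible_disturbance A B mu x0 (impulse d).
Proof.
move=> t i j.
have xt_ge0 := impulse_state_ge0 t.
have := undisturbed_ge0 xt_ge0 (mu_adm t xt_ge0) i j.
rewrite mxE -oppr_le0 => h; rewrite mxE; apply: le_trans h _.
by case: t {xt_ge0} => [|t] /=; [have := d_ge0 i j|]; rewrite mxE.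
Qed.

(** The kick [d] at time 0 costs the adversary [gamma . d] at once and raises by
    [pseq k . d] the bound on the undisturbed continuation. For [d = 0] this is
    the lower bound on the value; when [pseq k] is not below [gamma], large
    multiples of a suitable [d] make the cost arbitrarily large. *)
Lemma impulse_cost_ge k :
  ((dotv (pseq k.+1) x0 + dotv (pseq k - gamma) d)%:E
    <= total_cost A B s r gamma mu x0 (impulse d))%E.
Proof.
(* Horizons [T.+1] with [k <= T] suffice: the tail is then bounded by [pseq T],
   hence by [pseq k]. *)
apply: (@limn_esup_ge _ _ _ k.+1) => -[//|T] kT; rewrite lee_fin.
rewrite big_nat_recl //.
have abs_d : mxabs d = d by exact: mxabs_id.
have abs_0 : mxabs (0 : 'cV[R]_n) = 0 by apply: mxabs_id => i j.
have dyn t : x t.+2 = A *m x t.+1 + B *m u t.+1 by rewrite /= addr0.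
have x_ge0 t : 0 <=m x t.+1 by exact: impulse_state_ge0.
have := undisturbed_cost_ge T dyn (fun t => mu_adm t.+1 (x_ge0 t)).
rewrite (eq_bigr (fun t => stage_cost s r gamma (x t.+1) (u t.+1) 0)); last first.
  by move=> t _; rewrite /stage_cost abs_0 dotv0 subr0.
move=> tail; apply: le_trans (lerD (lexx _) tail).
rewrite /stage_cost /= abs_d.
have /= pkT := ler_dotvl (x_ge0 0%N) (@pseq_nondecreasing k T kT).
apply: le_trans (lerD (lexx _) pkT).
rewrite dotvDr (dotvBl (pseq k)) {1}/input /=.
have := bellman_le (pseq k) (mu_adm 0 x0_ge0).
lra.
Qed.

End Trajectories.

(** * Bounds on the value of the game *)

Lemma value_ge x0 d k : 0 <=m x0 -> 0 <=m d ->
  ((dotv (pseq k.+1) x0 + dotv (pseq k - gamma) d)%:E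
    <= value A B E s r gamma x0)%E.
Proof.
move=> x0_ge0 d_ge0; apply: le_ereal_inf_tmp => _ [mu mu_adm <-].
apply: le_trans (impulse_cost_ge mu_adm x0_ge0 d_ge0 k) _.
by apply: ereal_sup_ubound; exists (impulse d) => //; apply: impulse_admissible.
Qed.

(** Were [gamma i < pseq k i], impulses along the [i]-th axis would make the
    value infinite already from the initial state 0. *)
Lemma pseq_le_gamma :
  value A B E s r gamma 0 \is a fin_num -> forall k, pseq k <=m gamma.
Proof.
move=> /fineK; set v := fine _ => vE k i j; rewrite (ord1 j) leNgt.
apply/negP => gp.
have impulse_le c : 0 <= c -> c * (pseq k i 0 - gamma i 0) <= v.
  move=> c0; have d0 : 0 <=m c *: delta_mx i (0 : 'I_1).
    by move=> a b; rewrite !mxE mulr_ge0.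
  have := value_ge k (fun _ _ => lexx _) d0.
  by rewrite -vE lee_fin dotv0 add0r dotv_scale_delta !mxE.
have v0 : 0 <= v by have := impulse_le 0 (lexx _); rewrite mul0r.
have e0 : 0 < pseq k i 0 - gamma i 0 by rewrite subr_gt0.
(* This impulse size makes the lower bound equal to [v + 1]. *)
have := impulse_le ((v + 1) / (pseq k i 0 - gamma i 0)).
rewrite divfK ?gt_eqF //.
by move=> /(_ (divr_ge0 (addr_ge0 v0 ler01) (ltW e0))); lra.
Qed.

Lemma value_ge_lim x0 (p : 'cV[R]_n) : 0 <=m x0 -> pseq @ \oo --> p ->
  ((dotv p x0)%:E <= value A B E s r gamma x0)%E.
Proof.
move=> x0_ge0 pp.
have pk_le k : ((dotv (pseq k.+1) x0)%:E <= value A B E s r gamma x0)%E.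
  by have := @value_ge x0 0 k x0_ge0 (fun _ _ => lexx _); rewrite dotv0 addr0.
case: value pk_le => [v| |] pk_le; last 2 first.
- exact: leey.
- by have := pk_le 0%N; rewrite leeNy_eq.
have := cvg_dotvl (x := x0) pp; rewrite -cvg_shiftS => cp.
rewrite lee_fin; apply: (cvgr_to_le cp); apply: nearW => k.
by rewrite -lee_fin; exact: pk_le.
Qed.

(** Under the sign feedback each stage costs at most the decrease of the storage
    function [p . x], because [p <= gamma] makes the disturbance penalty outweigh
    what the disturbance adds to [p . x]. The sum telescopes, and the remaining
    term [- p . x_T] is nonpositive. *)
Lemma worst_cost_gain_le x0 p : 0 <=m x0 -> 0 <=m p -> p <=m gamma ->
  p = bellman p ->
  (worst_cost A B s r gamma (fun _ x => - (gain B E r p *m x))%R x0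
    <= (dotv p x0)%:E)%E.
Proof.
move=> x0_ge0 p0 pg pE; apply: ge_ereal_sup => _ [w w_adm <-].
apply: limn_esup_le => T; rewrite lee_fin.
set mu := fun _ _ => _ in w_adm *; set x := state A B mu w x0.
have x_ge0 := state_ge0 x0_ge0 w_adm.
have stage_le t : stage_cost s r gamma (x t) (input A B mu w x0 t) (w t) <=
    - (dotv p (x t.+1) - dotv p (x t)).
  have pw : dotv p (w t) <= dotv gamma (mxabs (w t)).
    apply: le_trans (ler_dotvl (mxabs_ge0 _) pg).
    rewrite !dotvE; apply: ler_sum => i _; rewrite [mxabs _ _ _]mxE.
    by apply: ler_wpM2l (ler_norm _); have := p0 i 0; rewrite mxE.
  have xS : dotv p (x t.+1) = dotv p (A *m x t + B *m mu t (x t)) + dotv p (w t).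
    by rewrite -dotvDr.
  have := bellman_gainE p (x t); rewrite -pE -/(mu t (x t)).
  by rewrite /stage_cost /input -/x xS; move: pw; lra.
apply: le_trans (ler_sum_nat (fun t _ => stage_le t)) _.
rewrite sumrN telescope_sumr //= opprB gerBl.
exact: dotv_ge0 (x_ge0 T).
Qed.

Lemma value_gain x0 (p : 'cV[R]_n) : 0 <=m x0 -> 0 <=m p -> p <=m gamma ->
  pseq @ \oo --> p ->
  value A B E s r gamma x0 = (dotv p x0)%:E /\
  optimal_policy A B E s r gamma (fun _ x => - (gain B E r p *m x)) x0.
Proof.
move=> x0_ge0 p0 pg pp.
have lo := value_ge_lim x0_ge0 pp.
have up := worst_cost_gain_le x0_ge0 p0 pg (pseq_lim_fixpoint pp).
have mid : (value A B E s r gamma x0 <=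
    worst_cost A B s r gamma (fun _ x => - (gain B E r p *m x))%R x0)%E.
  apply: ereal_inf_lbound; eexists; last reflexivity; exact: gain_admissible.
have vE : value A B E s r gamma x0 = (dotv p x0)%:E.
  by apply/eqP; rewrite eq_le lo andbT; apply: le_trans mid up.
split=> //; split; first exact: gain_admissible.
by apply/eqP; rewrite eq_le mid andbT vE.
Qed.

End Problem.

(** * The equivalence and the optimal control law *)

Theorem theorem4 (R : realType) (n m : nat)
    (A : 'M[R]_n) (B : 'M[R]_(n, m)) (E : 'M[R]_(m, n))
    (s : 'cV[R]_n) (r : 'cV[R]_m) (gamma : 'cV[R]_n)
    (A_ge0 : 0 <=m A) (E_ge0 : 0 <=m E) (s_ge0 : 0 <=m s)
    (gamma_ge0 : 0 <=m gamma)
    (BE_le_A : mxabs B *m E <=m A)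
    (Er_le_s : E^T *m mxabs r <=m s) :
  [<-> forall x0 : 'cV[R]_n, 0 <=m x0 ->
         value A B E s r gamma x0 \is a fin_num;
       exists p : 'cV[R]_n,
         [/\ pseq A B E s r @ \oo --> p, 0 <=m p & p <=m gamma];
       exists p : 'cV[R]_n,
         [/\ 0 <=m p,
             p = s + A^T *m p - E^T *m mxabs (r + B^T *m p)
           & p <=m gamma] ]
  /\
  ((forall x0 : 'cV[R]_n, 0 <=m x0 ->
      value A B E s r gamma x0 \is a fin_num) ->
   exists p : 'cV[R]_n,
     [/\ pseq A B E s r @ \oo --> p,
         0 <=m p,
         p <=m gamma,
         p = s + A^T *m p - E^T *m mxabs (r + B^T *m p)
       & forall x0 : 'cV[R]_n, 0 <=m x0 ->
           value A B E s r gamma x0 = (dotv p x0)%:E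
           /\ optimal_policy A B E s r gamma
                (fun _ x => - (gain B E r p *m x)) x0]).
Proof.
have fin_cvg : (forall x0 : 'cV[R]_n, 0 <=m x0 ->
    value A B E s r gamma x0 \is a fin_num) ->
    exists p : 'cV[R]_n, [/\ pseq A B E s r @ \oo --> p, 0 <=m p & p <=m gamma].
  move=> /(_ 0 (fun _ _ => lexx _)) fin0.
  apply: pseq_bounded_cvg => //; exact: pseq_le_gamma.
split; last first.
  move=> /fin_cvg [p [pp p0 pg]]; exists p; split=> //.
    exact: pseq_lim_fixpoint.
  by move=> x0 x0_ge0; apply: value_gain.
tfae; first exact: fin_cvg.
- by move=> [p [pp p0 pg]]; exists p; split=> //; apply: pseq_lim_fixpoint.
- move=> [q [q0 qE qg]] x0 x0_ge0.
  have pq := pseq_le_fixpoint E_ge0 BE_le_A q0 (esym qE).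
  have [p [pp p0 p_le_q]] := pseq_bounded_cvg E_ge0 BE_le_A Er_le_s pq.
  have [-> //] := value_gain E_ge0 BE_le_A Er_le_s x0_ge0 p0
    (mxle_trans p_le_q qg) pp.
Qed.
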